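(* For all $k\geq2$, the $3$-restricted edge-connectivity of the DCell $D_{k,2}$ satisfies $\lambda_3(D_{k,2})=3n+3k-7$ with $n=2$, i.e. $\lambda_3(D_{k,2})=3k-1$.
   Context: DCell $D_{k,n}$ ($n\geq 2$, $k\geq 0$) is defined recursively. $D_{0,n}$ is the complete graph $K_n$ on vertices $0,1,\dots,n-1$. Let $t_{k,n}=|V(D_{k,n})|$. For $k\geq1$, $D_{k,n}$ is built from $t_{k-1,n}+1$ disjoint copies $D^0_{k-1,n},\dots,D^{t_{k-1,n}}_{k-1,n}$ of $D_{k-1,n}$; a vertex of copy $D^i_{k-1,n}$ is labeled $(i,a_{k-1},\dots,a_0)$, where $(a_{k-1},\dots,a_0)$ is its label in $D_{k-1,n}$, and its index within the copy is $uid_{k-1}=a_0+\sum_{l=1}^{k-1}a_l t_{l-1,n}$. For each pair $a<b$ of copy indices, one edge joins the vertex of $D^a_{k-1,n}$ with $uid_{k-1}=b-1$ to the vertex of $D^b_{k-1,n}$ with $uid_{k-1}=a$. An edge set $F$ is a $3$-restricted edge-cut of $G$ if $G-F$ is disconnected and every component of $G-F$ has at least $3$ vertices; $\lambda_3(G)$ is the minimum size of such a cut. *)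

(* Defs.v *)
(* MathComp *)
From mathcomp Require Import all_boot.

Set Implicit Arguments.
Unset Strict Implicit.
Unset Printing Implicit Defensive.

Section EdgeCuts.

(* A finite simple graph is a symmetric irreflexive adjacency relation e;
   edges are represented as the two-element sets of their endpoints. *)
Variables (T : finType) (e : rel T).
Implicit Types (F : {set {set T}}) (x y : T) (h m : nat).

Definition edges : {set {set T}} :=
  [set [set p.1; p.2] | p : T * T & e p.1 p.2].

Definition del_edges F : rel T := [rel x y | e x y && ([set x; y] \notin F)].

Definition connected (e' : rel T) : Prop := forall x y, connect e' x y.

Definition component (e' : rel T) x : {set T} := [set y | connect e' x y].

Definition restricted_edge_cut h F : Prop :=
  [/\ F \subset edges,
      ~ connected (del_edges F)
    & forall x, h <= #|component (del_edges F) x|].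

(* A relation rather than a function, since a graph need not have any
   h-restricted edge-cut. *)
Definition is_restricted_edge_connectivity h m : Prop :=
  (exists2 F, restricted_edge_cut h F & #|F| = m) /\
  (forall F, restricted_edge_cut h F -> m <= #|F|).

End EdgeCuts.

Section DCell.

(* The label (a_k, ..., a_0) is encoded as (a_k, (..., (a_1, a_0))). *)
Fixpoint dcell_vertex (k n : nat) : finType :=
  if k is k'.+1 then
    ('I_(#|dcell_vertex k' n|.+1) * dcell_vertex k' n)%type : finType
  else 'I_n : finType.

Definition dcell_t (k n : nat) : nat := #|dcell_vertex k n|.

Fixpoint dcell_uid (k n : nat) : dcell_vertex k n -> nat :=
  match k return dcell_vertex k n -> nat with
  | 0 => fun a => nat_of_ord a
  | k'.+1 => fun u => dcell_uid u.2 + u.1 * dcell_t k' n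
  end.

(* Oriented from the lower copy index u.1 to the higher one v.1. *)
Definition dcell_link (k n : nat) (u v : dcell_vertex k.+1 n) : bool :=
  [&& u.1 < v.1, dcell_uid u.2 == v.1 - 1 & dcell_uid v.2 == u.1].

Fixpoint dcell (k n : nat) : rel (dcell_vertex k n) :=
  match k return rel (dcell_vertex k n) with
  | 0 => fun a b => a != b
  | k'.+1 => fun u v =>
      [|| (u.1 == v.1) && dcell u.2 v.2, dcell_link u v | dcell_link v u]
  end.

Lemma dcell_sym (k n : nat) : symmetric (@dcell k n).
Proof.
elim: k => [|k IHk] u v /=; first by rewrite eq_sym.
by rewrite eq_sym IHk [dcell_link u v || _]orbC.
Qed.

Lemma dcell_irr (k n : nat) : irreflexive (@dcell k n).
Proof.
elim: k => [|k IHk] u /=; first by rewrite eqxx.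
by rewrite IHk andbF /dcell_link ltnn.
Qed.

End DCell.

Arguments dcell k n : clear implicits.

(* Main.v *)
(* Let A be a set of vertices of D_k.  By induction on k, its boundary has at
   least k + 1, 2k or 3k - 1 edges as soon as A and its complement have at least
   1, 2 or 3 vertices.  Of the t + 1 copies of D_(k-1), each one split by A
   contributes at least k edges, so three split copies suffice; if some copy
   lies inside A and some other outside, the edges joining such pairs number at
   least t minus the number of split copies, and t >= 3k - 1; otherwise, up to
   complement, A lies in at most two copies, and all but at most two of its
   vertices have their level-k edge leaving A.
   The bound is attained by the boundary of a path P on three vertices: a
   component C of the rest with at most two vertices would leave P :|: C a
   boundary of at most (3k - 1) - (k + 1) < 2k edges. *)
Require Import Defs.
From mathcomp Require Import all_boot.
From mathcomp Require Import zify.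

Set Implicit Arguments.
Unset Strict Implicit.
Unset Printing Implicit Defensive.

(** * Edge boundaries and the isoperimetric bounds *)

Section Boundary.

Variables (T : finType) (e : rel T).
Implicit Types (A : {set T}).

Definition bd A : nat := \sum_(x in A) \sum_(y in ~: A) e x y.

(** Subtraction is truncated, so at [k = 0] only the first of the three bounds says anything. *)
Definition isoperimetric (k : nat) : Prop :=
  forall A,
  [/\ 0 < #|A| -> 0 < #|~: A| -> k.+1 <= bd A,
      1 < #|A| -> 1 < #|~: A| -> 2 * k <= bd A
    & 2 < #|A| -> 2 < #|~: A| -> 3 * k - 1 <= bd A].

Lemma bd_setC A : symmetric e -> bd (~: A) = bd A.
Proof.
move=> esym; rewrite /bd setCK exchange_big /=.
by apply: eq_bigr => x _; apply: eq_bigr => y _; rewrite esym.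
Qed.

End Boundary.

(** * The recursive construction over an arbitrary graph with a vertex numbering *)

Section Copies.

Variables (V : finType) (e : rel V) (r : V -> 'I_#|V|) (s : 'I_#|V| -> V).
Hypotheses (rK : cancel r s) (sK : cancel s r).

Local Notation copies := ('I_#|V|.+1 * V)%type.
Implicit Types (A : {set copies}) (x y : copies) (i j : 'I_#|V|.+1).

(* The vertex of copy i with uid a is linked to copy [lift i a], which is a if
   a < i and a + 1 otherwise. *)
Definition port_target x : 'I_#|V|.+1 := lift x.1 (r x.2).

(** The level edge without an order on copy indices: each endpoint's port points to the other's
    copy. *)
Definition cross x y : bool :=
  (port_target x == y.1) && (port_target y == x.1).

Definition copies_rel : rel copies :=
  [rel x y | (x.1 == y.1) && e x.2 y.2 || cross x y].

(** The other end of the level edge at [x]: the vertex of the target copy whose port points back.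
    The default [x.2] is never reached, since a port never points to its own copy. *)
Definition nb x : copies :=
  (port_target x, oapp s x.2 (unlift (port_target x) x.1)).

Definition slice A i : {set V} := [set u | (i, u) \in A].

Lemma port_target_neq x : port_target x != x.1.
Proof. by rewrite eq_sym neq_lift. Qed.

Lemma port_target_inj i u v :
  port_target (i, u) = port_target (i, v) -> u = v.
Proof. by move/lift_inj/(can_inj rK). Qed.

Lemma port_exists i j : i != j -> exists u, port_target (i, u) = j.
Proof.
by case/unlift_some => w -> _; exists (s w); rewrite /port_target /= sK.
Qed.

Lemma crossE x y : cross x y = (y == nb x).
Proof.
rewrite /cross /nb; case: x y => [i u] [j v] /=.
rewrite xpair_eqE eq_sym; case: eqP => //= ->.
have ij := port_target_neq (i, u); case: (unlift_some ij) => w /= iE -> /=.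
rewrite /port_target /= {2}iE (inj_eq lift_inj).
by apply/eqP/eqP => [<-|->]; rewrite ?rK ?sK.
Qed.

(** The two kinds of adjacency exclude each other because [nb x] lies in another copy; hence degrees
    and boundaries split as sums. *)
Lemma copies_relE x y :
  copies_rel x y = ((x.1 == y.1) && e x.2 y.2) + (y == nb x) :> nat.
Proof.
rewrite /copies_rel /= crossE; case: (y =P nb x) => [->|_]; last first.
  by rewrite orbF addn0.
by rewrite orbT eq_sym (negPf (port_target_neq x)).
Qed.

Lemma copies_relC : symmetric e -> symmetric copies_rel.
Proof.
move=> esym x y.
by rewrite /copies_rel /= esym eq_sym /cross [in X in _ || X]andbC.
Qed.

Lemma sum_copies (F : copies -> nat) : \sum_x F x = \sum_i \sum_u F (i, u).
Proof. by rewrite pair_bigA; apply: eq_bigr => -[]. Qed.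

Lemma copies_degree x :
  \sum_y copies_rel x y = (\sum_v e x.2 v).+1.
Proof.
under eq_bigr do rewrite copies_relE.
rewrite big_split /= -[RHS]addn1; congr (_ + _); last first.
  by rewrite -big_mkcond /= big_pred1_eq.
rewrite sum_copies (bigD1 x.1) //= eqxx /= [X in _ + X]big1 ?addn0 // => j /negPf.
by rewrite eq_sym => ->; rewrite big1.
Qed.

Lemma card_slices A : #|A| = \sum_i #|slice A i|.
Proof.
rewrite -sum1_card big_mkcond /= sum_copies.
apply: eq_bigr => i _; rewrite -[RHS]sum1_card [RHS]big_mkcond /=.
by apply: eq_bigr => u _; rewrite inE.
Qed.

Lemma bd_copies A :
  bd copies_rel A =
  \sum_i bd e (slice A i) + #|[set x in A | nb x \notin A]|.
Proof.
rewrite /bd.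
under eq_bigr => x _.
  under eq_bigr do rewrite copies_relE.
  rewrite big_split /=; over.
rewrite big_split /=; congr (_ + _); last first.
  rewrite -[RHS]sum1_card.
  rewrite [RHS](eq_bigl (fun x => (x \in A) && (nb x \notin A))); last first.
    by move=> x; rewrite inE.
  rewrite [RHS]big_mkcondr /=; apply: eq_bigr => x _.
  rewrite -big_mkcondr /= (eq_bigl (fun y => (nb x \notin A) && (y == nb x))); last first.
    by move=> y; rewrite inE andbC; case: eqP => [->|]; rewrite ?andbT ?andbF.
  by case: (nb x \notin A); rewrite /= ?big_pred1_eq ?big_pred0_eq.
rewrite big_mkcond sum_copies /=.
apply: eq_bigr => i _; rewrite [RHS]big_mkcond /=.
apply: eq_bigr => u _; rewrite inE; case: ifP => // _.
rewrite big_mkcond sum_copies /=.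
rewrite (bigD1 i) //= eqxx /= [X in _ + X]big1 ?addn0 => [|j /negPf ji].
  by rewrite [RHS]big_mkcond /=; apply: eq_bigr => v _; rewrite !inE.
by rewrite big1 // => v _; rewrite eq_sym ji if_same.
Qed.

(** * Full, empty and split copies, and the induction step *)

Definition full A := [set i | slice A i == setT].
Definition empty A := [set i | slice A i == set0].
Definition split A := ~: (full A :|: empty A).

Lemma slice_setC A i : slice (~: A) i = ~: slice A i.
Proof. by apply/setP => u; rewrite !inE. Qed.

Lemma full_setC A : full (~: A) = empty A.
Proof.
by apply/setP => i; rewrite !inE slice_setC -(inj_eq (@setC_inj _)) setCK setCT.
Qed.

Lemma empty_setC A : empty (~: A) = full A.
Proof. by rewrite -[in RHS](setCK A) full_setC. Qed.

Lemma split_setC A : split (~: A) = split A.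
Proof. by rewrite /split full_setC empty_setC setUC. Qed.

Lemma card_copies_partition A :
  0 < #|V| -> #|full A| + #|empty A| + #|split A| = #|V|.+1.
Proof.
move=> V_gt0; rewrite /split -[in RHS](card_ord #|V|.+1) -(cardsC (full A :|: empty A)).
congr (_ + _); rewrite cardsU [full A :&: _](_ : _ = set0) ?cards0 ?subn0 //.
apply/setP => i; rewrite !inE; case: eqP => //= ->.
by apply/negbTE; rewrite -cards_eq0 cardsT -lt0n.
Qed.

Lemma split_sizes A i :
  i \in split A -> 0 < #|slice A i| /\ 0 < #|~: slice A i|.
Proof.
rewrite !inE negb_or => /andP[iF iE]; split; first by rewrite lt0n cards_eq0.
by rewrite lt0n cards_eq0 -(inj_eq (@setC_inj _)) setCK setC0.
Qed.

Lemma bd_split_full_empty k A : 0 < #|V| -> isoperimetric e k ->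
  #|split A| * k.+1 + #|full A| * #|empty A| <= bd copies_rel A.
Proof.
move=> V_gt0 iso; rewrite bd_copies; apply: leq_add.
  rewrite -sum_nat_const big_mkcond /=; apply: leq_sum => i _.
  by case: ifP => // /split_sizes[? ?]; case: (iso (slice A i)) => ->.
rewrite -cardsX; set B := [set x in A | _].
(* Sending a boundary vertex to its own copy and its target copy hits every pair of a full and an
   empty copy. *)
apply: leq_trans (leq_imset_card (fun x => (x.1, port_target x)) B).
apply: subset_leq_card; apply/subsetP => -[i j] /setXP[].
rewrite !inE => /eqP iF /eqP jE.
have i_in u : (i, u) \in A by move/setP/(_ u): iF; rewrite !inE.
have j_out v : (j, v) \notin A by move/setP/(_ v): jE; rewrite !inE => ->.
have /card_gt0P[u0 _] := V_gt0.
have: i != j by apply: contraNneq (j_out u0) => <-; apply: i_in.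
case/port_exists => u uj; apply/imsetP; exists (i, u); last by rewrite uj.
by rewrite inE i_in /nb uj j_out.
Qed.

(* Only the two ports joining copies i and j can be matched inside A. *)
Lemma card_boundary_two A i j :
  (forall m, m != i -> m != j -> slice A m = set0) ->
  #|A| - (i != j).*2 <= #|[set x in A | nb x \notin A]|.
Proof.
move=> A0.
have in_ij x : x \in A -> (x.1 == i) || (x.1 == j).
  case: x => m u Amu /=; apply/norP => -[mi mj].
  by move/setP/(_ u): (A0 m mi mj); rewrite !inE Amu.
suff bad : #|[set x in A | nb x \in A]| <= (i != j).*2.
  rewrite leq_subLR -(cardsID [set x | nb x \in A] A); apply: leq_add.
    by rewrite setIdE in bad.
  by apply: subset_leq_card; apply/subsetP => x; rewrite !inE andbC.
case: (eqVneq i j) => [ij|ij] /=.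
  rewrite leqn0 cards_eq0; apply/eqP/setP => x; rewrite !inE.
  apply/negbTE/andP => -[/in_ij xi /in_ij].
  by rewrite -ij !orbb in xi *; rewrite -(eqP xi) (negPf (port_target_neq x)).
have [u uP] := port_exists ij.
have [v vP] : exists v, port_target (j, v) = i by apply: port_exists; rewrite eq_sym.
apply: leq_trans (_ : #|[set (i, u); (j, v)]| <= _); last first.
  by rewrite cards2; case: (_ != _).
apply: subset_leq_card; apply/subsetP => -[m w].
rewrite !inE => /andP[/in_ij /= mij /in_ij].
have := port_target_neq (m, w); rewrite /= => mw.
case/orP: mij => /eqP mE; subst m; rewrite (negPf mw) ?orbF /= => /eqP tE.
  by apply/orP; left; rewrite -(@port_target_inj i w u) ?tE ?uP.
by apply/orP; right; rewrite -(@port_target_inj j w v) ?tE ?vP.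
Qed.

Lemma bd_copies_no_full k A :
  isoperimetric e k -> 3 * k + 2 <= #|V| ->
  #|full A| = 0 -> #|split A| <= 2 ->
  [/\ 0 < #|A| -> k.+2 <= bd copies_rel A,
      1 < #|A| -> 2 * k.+1 <= bd copies_rel A
    & 2 < #|A| -> 3 * k.+1 - 1 <= bd copies_rel A].
Proof.
move=> iso tk F0 S2.
have sl0 m : m \notin split A -> slice A m = set0.
  move/eqP: F0; rewrite cards_eq0 => /eqP F0.
  by rewrite /split F0 set0U inE negbK inE => /eqP.
have cA : #|A| = \sum_(m in split A) #|slice A m|.
  rewrite card_slices (bigID (mem (split A))) /= [X in _ + X]big1 ?addn0 //.
  by move=> m /sl0 ->; rewrite cards0.
have bdA : \sum_(m in split A) bd e (slice A m)
           + #|[set x in A | nb x \notin A]| <= bd copies_rel A.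
  by rewrite bd_copies leq_add2r [leqRHS](bigID (mem (split A))) /= leq_addr.
have [/eqP|] := posnP #|split A|.
  by rewrite cards_eq0 => /eqP S0; rewrite cA S0 big_set0.
rewrite leq_eqVlt => /orP[/eqP/esym/eqP/cards1P[i Si]|S_gt1].
  have iS : i \in split A by rewrite Si set11.
  have := @card_boundary_two A i i; rewrite eqxx subn0 => nbA.
  have {}nbA : #|A| <= #|[set x in A | nb x \notin A]|.
    by apply: nbA => m mi _; apply: sl0; rewrite Si inE.
  move: cA bdA nbA; rewrite Si !big_set1 => -> bdA nbA.
  have [a0 a0'] := split_sizes iS; have := cardsC (slice A i).
  (* Either the slice's complement in its copy is large enough for the bounds on [e], or it is so
     small that [3 * k + 2 <= #|V|] makes the slice itself large. *)
  by case: (iso (slice A i)) => /(_ a0 a0') h1 h2 h3 hc; split; lia.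
have /cards2P[i [j [ij Sij]]] : #|split A| == 2 by rewrite eqn_leq S2.
have iS : i \in split A by rewrite Sij !inE eqxx.
have jS : j \in split A by rewrite Sij !inE eqxx orbT.
have := @card_boundary_two A i j; rewrite ij => nbA.
have {}nbA : #|A| - 2 <= #|[set x in A | nb x \notin A]|.
  by apply: nbA => m mi mj; apply: sl0; rewrite Sij !inE negb_or mi.
move: cA bdA nbA; rewrite Sij !big_setU1 ?inE //= !big_set1 => -> bdA nbA.
have [a0 a0'] := split_sizes iS; have := cardsC (slice A i).
have [b0 b0'] := split_sizes jS; have := cardsC (slice A j).
case: (iso (slice A i)) => /(_ a0 a0') h1 h2 h3.
(* The tight case has slices of sizes 2 and 1: 2k + (k + 1) + (3 - 2) = 3(k + 1) - 1. *)
by case: (iso (slice A j)) => /(_ b0 b0') g1 g2 g3 gc hc; split; lia.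
Qed.

Lemma isoperimetric_copies k :
  symmetric e -> isoperimetric e k -> 3 * k + 2 <= #|V| ->
  isoperimetric copies_rel k.+1.
Proof.
move=> esym iso tk A.
have V0 : 0 < #|V| by lia.
have cP := card_copies_partition A V0.
have bdA := bd_split_full_empty A V0 iso.
have [S2|S3] := leqP #|split A| 2; last by split; nia.
have [F0|F1] := posnP #|full A|.
  case: (bd_copies_no_full iso tk F0 S2) => h1 h2 h3.
  by split=> a _; [apply: h1 | apply: h2 | apply: h3].
(* With f full and e empty copies, both positive, f e >= f + e - 1, which is [#|V|] minus the number
   of split copies. *)
have [E0|E1] := posnP #|empty A|; last by split; nia.
have := @bd_copies_no_full k (~: A) iso tk.
rewrite full_setC split_setC (bd_setC _ (copies_relC esym)).
case/(_ E0 S2) => h1 h2 h3.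
by split=> _ a; [apply: h1 | apply: h2 | apply: h3].
Qed.

End Copies.

(** * DCell as an instance of the construction *)

Lemma dcell_uid_lt k n (u : dcell_vertex k n) : dcell_uid u < dcell_t k n.
Proof.
elim: k u => [|k IHk] u /=; first by rewrite /dcell_t card_ord.
have u1_le : u.1 <= dcell_t k n := ltn_ord u.1.
rewrite [dcell_t k.+1 n]/dcell_t /= card_prod card_ord mulSn -addSn.
by rewrite leq_add ?IHk // leq_mul2r u1_le orbT.
Qed.

(** Division by [dcell_t k n] recovers the copy index as quotient and the inner uid as remainder. *)
Lemma dcell_uid_inj k n : injective (@dcell_uid k n).
Proof.
elim: k => [|k IHk] u v /=; first exact: val_inj.
have u_lt := dcell_uid_lt u.2; have v_lt := dcell_uid_lt v.2 => uv.
have t_gt0 : 0 < dcell_t k n by lia.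
have : dcell_uid u.2 = dcell_uid v.2.
  have := congr1 (modn^~ (dcell_t k n)) uv.
  by rewrite !(addnC (dcell_uid _)) !modnMDl !modn_small.
move/IHk => uv2; have : u.1 = v.1.
  apply/val_inj/eqP; rewrite -(eqn_pmul2r t_gt0).
  by move: uv; rewrite uv2 => /addnI ->.
by case: u v uv2 {uv u_lt v_lt} => [? ?] [? ?] /= -> ->.
Qed.

Definition dcell_rank k n (u : dcell_vertex k n) : 'I_#|dcell_vertex k n| :=
  Ordinal (dcell_uid_lt u).

Lemma dcell_rank_bij k n : bijective (@dcell_rank k n).
Proof.
apply: inj_card_bij; last by rewrite card_ord.
by move=> u v [/dcell_uid_inj].
Qed.

(** For copies i < j, lifting a past i gives j exactly when a = j - 1, and lifting b past j gives i
    exactly when b = i: these are the conditions of [dcell_link]. *)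
Lemma dcellS k n (u v : dcell_vertex k.+1 n) :
  dcell k.+1 n u v = copies_rel (dcell k n) (@dcell_rank k n) u v.
Proof.
rewrite /= /copies_rel /=; congr (_ || _).
rewrite /dcell_link /cross /port_target -!val_eqE /= /bump.
move: (nat_of_ord u.1) (nat_of_ord v.1) (dcell_uid u.2) (dcell_uid v.2) => i j a b.
by apply/idP/idP; lia.
Qed.

Lemma isoperimetric_dcell0 : isoperimetric (dcell 0 2) 0.
Proof.
move=> A; split=> // /card_gt0P[x xA] /card_gt0P[y yA].
rewrite /bd (bigD1 x) //= (bigD1 y) //=.
suff -> : x != y by [].
by apply: contraTneq yA => <-; rewrite inE negbK.
Qed.

Lemma dcell_t_ge k : 3 * k + 2 <= dcell_t k 2.
Proof.
elim: k => [|k IHk]; first by rewrite /dcell_t card_ord.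
rewrite [dcell_t k.+1 2]/dcell_t /= card_prod card_ord -/(dcell_t k 2).
move: (dcell_t k 2) IHk => t; nia.
Qed.

Lemma eq_bd (T : finType) (e e' : rel T) (A : {set T}) :
  e =2 e' -> bd e A = bd e' A.
Proof.
by move=> ee'; apply: eq_bigr => x _; apply: eq_bigr => y _; rewrite ee'.
Qed.

Lemma isoperimetric_dcell k : isoperimetric (dcell k 2) k.
Proof.
elim: k => [|k IHk]; first exact: isoperimetric_dcell0.
have [s rK sK] := dcell_rank_bij k 2; move=> A.
rewrite (eq_bd A (@dcellS k 2)).
exact: (isoperimetric_copies rK sK (@dcell_sym k 2) IHk (dcell_t_ge k)).
Qed.

Lemma dcell_degree k (x : dcell_vertex k 2) : \sum_y dcell k 2 x y = k.+1.
Proof.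
elim: k x => [|k IHk] x; last first.
  have [s rK sK] := dcell_rank_bij k 2.
  under eq_bigr do rewrite dcellS.
  by rewrite (copies_degree (dcell k 2) rK sK) IHk.
rewrite !big_ord_recl big_ord0 /=.
by case: x => [[|[|//]]].
Qed.

(** * Restricted edge-cuts and boundaries of vertex sets *)

Section RestrictedCuts.

Variables (T : finType) (e : rel T).
Hypothesis esym : symmetric e.
Implicit Types (A : {set T}) (F : {set {set T}}).

Definition cut_pairs A : {set T * T} :=
  [set p | [&& p.1 \in A, p.2 \notin A & e p.1 p.2]].

Definition cut A : {set {set T}} := [set [set p.1; p.2] | p in cut_pairs A].

(** The set [A] orients each edge: its endpoint in [A] comes first. *)
Lemma cut_inj A : {in cut_pairs A &, injective (fun p => [set p.1; p.2])}.
Proof.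
move=> [x y] [x' y']; rewrite !inE /= => /and3P[xA yA _] /and3P[xA' yA' _] E.
have xE : x = x'.
  have : x \in [set x'; y'] by rewrite -E set21.
  by rewrite !inE => /orP[/eqP // | /eqP xy]; rewrite -xy xA in yA'.
congr (_, _) => //.
have : y \in [set x'; y'] by rewrite -E set22.
by rewrite !inE => /orP[/eqP yx | /eqP //]; rewrite yx xA' in yA.
Qed.

Lemma card_cut A : #|cut A| = bd e A.
Proof.
rewrite card_in_imset; last exact: cut_inj.
rewrite -sum1_card /bd pair_big_dep /= [RHS]big_mkcond [LHS]big_mkcond /=.
apply: eq_bigr => p _; rewrite !inE andbA.
by case: (p.1 \in A); case: (p.2 \in A); case: (e _ _).
Qed.

Lemma cut_edges A : cut A \subset edges e.
Proof.
apply/subsetP => E /imsetP[p]; rewrite inE => /and3P[_ _ ep] ->.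
by apply: imset_f; rewrite inE.
Qed.

Lemma mem_cut A x y : x \in A -> y \notin A -> e x y -> [set x; y] \in cut A.
Proof.
by move=> xA yA exy; apply/imsetP; exists (x, y) => //; rewrite inE xA yA.
Qed.

Lemma cut_crosses A x y :
  [set x; y] \in cut A -> (x \in A) != (y \in A).
Proof.
case/imsetP => -[u v]; rewrite inE /= => /and3P[uA vA _] E.
have : u \in [set x; y] by rewrite E set21.
have : v \in [set x; y] by rewrite E set22.
rewrite !inE => /orP[]/eqP vE /orP[]/eqP uE; move: uA vA; rewrite uE vE.
- by move=> ->.
- by move=> -> /negPf->.
- by move=> -> /negPf->.
- by move=> ->.
Qed.

Lemma del_edges_sym F : symmetric (del_edges e F).
Proof. by move=> x y; rewrite /del_edges /= esym setUC. Qed.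

Lemma cut_component_subset F x : cut (component (del_edges e F) x) \subset F.
Proof.
apply/subsetP => E /imsetP[[u v]]; rewrite !inE /= => /and3P[xu xv euv] ->.
apply: contraNT xv => uvF; apply: connect_trans xu (connect1 _).
by rewrite /del_edges /= euv.
Qed.

(** The boundary of a component of the remaining graph lies in [F], and the complement of that
    component contains another one, so both sides have at least [h] vertices. *)
Lemma restricted_edge_cut_bound h m F :
  (forall A, h <= #|A| -> h <= #|~: A| -> m <= bd e A) ->
  restricted_edge_cut e h F -> m <= #|F|.
Proof.
move=> bdP [_ Fdis Fh].
case: (boolP [forall x, forall y, connect (del_edges e F) x y]) => [/forallP con|].
  by case: Fdis => x y; apply: (forallP (con x)).
case/forallPn => x /forallPn[y xy].
apply: leq_trans (subset_leq_card (cut_component_subset F x)).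
rewrite card_cut; apply: bdP; first exact: Fh.
apply: leq_trans (Fh y) (subset_leq_card _); apply/subsetP => z.
rewrite !inE => yz; apply: contra xy => xz; apply: connect_trans xz _.
by rewrite (sym_connect_sym (del_edges_sym F)).
Qed.

Lemma closed_cut A : closed (del_edges e (cut A)) A.
Proof.
apply: (intro_closed (sym_connect_sym (del_edges_sym _))) => x y /andP[exy].
by move=> xyA xA; apply: contraNT xyA => yA; apply: mem_cut.
Qed.

Lemma not_connected_cut A :
  0 < #|A| -> 0 < #|~: A| -> ~ connected (del_edges e (cut A)).
Proof.
case/card_gt0P => x xA /card_gt0P[y]; rewrite inE => yA con.
by move: yA; rewrite -(closed_connect (@closed_cut A) (con x y)) xA.
Qed.

(** Every edge leaving [C] ends in [A]. Absorbing [C] into [A] thus removes exactly these edges from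
    the boundary and adds none. *)
Lemma bd_component A u (C := component (del_edges e (cut A)) u) :
  u \notin A -> bd e (A :|: C) + bd e C <= bd e A.
Proof.
move=> uA; rewrite -!card_cut.
have CA v : v \in C -> v \notin A.
  by rewrite inE => uv; rewrite -(closed_connect (@closed_cut A) uv).
have cutC : cut C \subset cut A := cut_component_subset (cut A) u.
have dis : [disjoint cut (A :|: C) & cut C].
  apply/pred0P => E /=; apply/negbTE/andP => -[EAC EC].
  move: (EC) => /imsetP[[v w]]; rewrite inE /= => /and3P[vC wC _] Evw.
  have := subsetP cutC _ EC; move: EAC.
  rewrite Evw => /cut_crosses crossAC /cut_crosses; move: crossAC.
  by rewrite !in_setU vC orbT (negPf wC) orbF (negPf (CA v vC)); case: (w \in A).
have /eqP <- : #|cut (A :|: C) :|: cut C| == #|cut (A :|: C)| + #|cut C|.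
  by rewrite (leq_card_setU _ _).2.
apply: subset_leq_card; rewrite subUset cutC andbT.
apply/subsetP => E /imsetP[[v w]]; rewrite !inE /= negb_or.
case/and3P=> vAC /andP[wA wC] evw ->.
case/orP: vAC => [vA|vC]; first exact: mem_cut.
by apply: (subsetP cutC); apply: mem_cut; rewrite ?inE.
Qed.

End RestrictedCuts.

(** * The cut around a path on three vertices *)

Section PathCut.

Variables (T : finType) (e : rel T) (k : nat) (x y z : T).
Hypotheses (esym : symmetric e) (eirr : irreflexive e).
Hypothesis regular : forall u, \sum_v e u v = k.+1.
Hypotheses (eyx : e y x) (eyz : e y z) (xz : x != z).

Definition path3 : {set T} := [set x; y; z].

Lemma path3_neq : (y != x) && (y != z).
Proof.
apply/andP; split.
  by apply: contraTneq eyx => <-; rewrite eirr.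
by apply: contraTneq eyz => <-; rewrite eirr.
Qed.

Lemma sum_path3 (f : T -> nat) : \sum_(u in path3) f u = f x + f y + f z.
Proof.
have /andP[yx yz] := path3_neq.
have xy : x \notin [set y] by rewrite inE eq_sym.
have zxy : z \notin [set x; y] by rewrite !inE negb_or ![z == _]eq_sym xz.
by rewrite /path3 setUC !big_setU1 //= big_set1 addnC.
Qed.

Lemma card_path3 : #|path3| = 3.
Proof. by rewrite -sum1_card sum_path3. Qed.

(** The degrees sum to 3(k + 1), and the two path edges account for 4 of this; an edge between [x]
    and [z] would only lower the count. *)
Lemma bd_path3 : bd e path3 <= 3 * k - 1.
Proof.
have deg u : \sum_(v in path3) e u v + \sum_(v in ~: path3) e u v = k.+1.
  rewrite -(regular u) [RHS](bigID (mem path3)) /=; congr (_ + _).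
  by apply: eq_bigl => v; rewrite inE.
have := deg x; have := deg y; have := deg z.
rewrite /bd !sum_path3 (esym x y) (esym z y) eyx eyz; lia.
Qed.

Lemma path3_cut : 1 < k -> isoperimetric e k -> 6 < #|T| ->
  restricted_edge_cut e 3 (cut e path3).
Proof.
move=> k_gt1 iso T_gt6.
have cP := cardsC path3; rewrite card_path3 in cP.
split; first exact: cut_edges.
  by apply: not_connected_cut; rewrite ?card_path3 //; lia.
have Pconn u v : u \in path3 -> v \in path3 -> e u v ->
    connect (del_edges e (cut e path3)) u v.
  move=> uP vP euv; apply: connect1; rewrite /del_edges /= euv.
  by apply/negP => /cut_crosses; rewrite uP vP.
have [xP yP zP] : [/\ x \in path3, y \in path3 & z \in path3].
  by rewrite !inE !eqxx !orbT.
have csym := sym_connect_sym (del_edges_sym esym (cut e path3)).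
move=> u; have [uP|uP] := boolP (u \in path3).
  rewrite -card_path3; apply/subset_leq_card/subsetP => v vP; rewrite inE.
  have toy w : w \in path3 -> connect (del_edges e (cut e path3)) y w.
    rewrite !inE -orbA => /or3P[]/eqP->; first exact: Pconn.
      exact: connect0.
    exact: Pconn.
  by apply: connect_trans (toy v vP); rewrite csym toy.
rewrite leqNgt; apply/negP => C_lt3.
have := bd_component esym uP; set C := component _ _ in C_lt3 * => bdC.
have cC := cardsC C; have cPC := cardsC (path3 :|: C).
have := cardsUI path3 C; rewrite card_path3 => cU.
have C_gt0 : 0 < #|C| by apply/card_gt0P; exists u; rewrite inE.
have := bd_path3.
case: (iso C) => h1 _ _; case: (iso (path3 :|: C)) => _ h2 _.
have {}h1 : k.+1 <= bd e C by apply: h1 => //; lia.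
(* At most five vertices lie in the union, so [6 < #|T|] leaves at least two outside. *)
have {}h2 : 2 * k <= bd e (path3 :|: C).
  have cU' : #|path3| <= #|path3 :|: C| by rewrite subset_leq_card ?subsetUl.
  by rewrite card_path3 in cU'; apply: h2; lia.
lia.
Qed.

End PathCut.

Theorem theorem12 (k : nat) (hk : 2 <= k) :
  is_restricted_edge_connectivity (dcell k 2) 3 (3 * k - 1).
Proof.
have lower F : restricted_edge_cut (dcell k 2) 3 F -> 3 * k - 1 <= #|F|.
  apply: restricted_edge_cut_bound => [|A]; first exact: dcell_sym.
  by case: (@isoperimetric_dcell k A).
split=> //.
have tk := dcell_t_ge k; rewrite /dcell_t in tk.
have /card_gt0P[y _] : 0 < #|dcell_vertex k 2| by lia.
(* Any vertex can be the middle of the path, as its degree is k + 1 > 1. *)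
have /card_gt1P[x [z [yx yz xz]]] : 1 < #|[set v | dcell k 2 y v]|.
  rewrite -sum1_card big_mkcond /= (eq_bigr (fun v => dcell k 2 y v : nat)).
    by rewrite dcell_degree; lia.
  by move=> v _; rewrite inE.
rewrite !inE in yx yz.
have cutP := path3_cut (@dcell_sym k 2) (@dcell_irr k 2) (@dcell_degree k) yx yz xz
  hk (@isoperimetric_dcell k).
exists (cut (dcell k 2) (path3 x y z)); first by apply: cutP; lia.
apply/eqP; rewrite eqn_leq lower ?andbT; last by apply: cutP; lia.
rewrite card_cut.
exact: (bd_path3 (@dcell_sym k 2) (@dcell_irr k 2) (@dcell_degree k) yx yz xz).
Qed.
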